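(* Let $S_n=\sum_{k=1}^n X_k$, $S_0=0$, be the unbiased random walk, where $X_1,X_2,\dots$ are independent and identically distributed random variables with $\mathcal P(X_k=1)=\mathcal P(X_k=-1)=\frac12$. Let $A,B\in\mathbb R$, $A,B>0$, and let $\tau=\min\{n\ge 0: S_n=A\ \text{or}\ S_n=-B\}$ be the first passage time through $A$ or $-B$. Then $$\mathcal P(S_\tau=A)=\frac{B}{A+B},\qquad \mathcal P(S_\tau=-B)=\frac{A}{A+B},\qquad \mathbb E[\tau]=AB .$$
   Context: $\mathcal P(S_\tau=A)$ is the probability that the random walk reaches $A$ before $-B$, and similarly $\mathcal P(S_\tau=-B)$ is the probability that it reaches $-B$ before $A$; $\mathbb E[\tau]$ is the expected number of steps needed to reach one of the two barriers.
   Formalization: The barriers A and B are additionally assumed to be integers; for non-integer A or B the walk never equals that barrier, so its hitting probability is 0 and the claimed formulas fail (e.g. A = B = 1/2). *)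

(* Defs.v *)
From HB Require Import structures.
From mathcomp Require Import all_boot all_order all_algebra.
From mathcomp Require Import all_classical all_reals all_analysis.

Set Implicit Arguments.
Unset Strict Implicit.
Unset Printing Implicit Defensive.
Import Order.TTheory GRing.Theory Num.Theory.
Import numFieldNormedType.Exports.

Local Open Scope classical_set_scope.
Local Open Scope ring_scope.

Definition mutually_independent (d : measure_display) (T : measurableType d)
    (R : realType) (P : probability T R) (X : nat -> {RV P >-> R}) : Prop :=
  forall (J : seq nat) (E : nat -> set R),
    uniq J -> (forall i, measurable (E i)) ->
    P (\bigcap_(i in [set` J]) (X i @^-1` E i)) =
    (\prod_(i <- J) P (X i @^-1` E i))%E.
Arguments mutually_independent {d T R} P X.

Definition identically_distributed (d : measure_display)
    (T : measurableType d) (R : realType) (P : probability T R)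
    (X : nat -> {RV P >-> R}) : Prop :=
  forall (i j : nat) (E : set R),
    measurable E -> distribution P (X i) E = distribution P (X j) E.
Arguments identically_distributed {d T R} P X.

(* The steps are indexed from 0: [X k] is the (k+1)-st step, so that
   [walk X n] is the sum of the first n steps. *)
Definition walk (T : Type) (R : realType) (X : nat -> T -> R) (n : nat)
    (w : T) : R :=
  \sum_(k < n) X k w.

(* The infimum is a minimum whenever a barrier is reached, and is +oo
   otherwise. *)
Definition first_passage (T : Type) (R : realType) (X : nat -> T -> R)
    (A B : R) (w : T) : \bar R :=
  ereal_inf [set (n%:R)%:E | n in [set n | walk X n w = A \/ walk X n w = - B]].

(* The event {S_tau = x}, which includes tau < +oo. *)
Definition stopped_at (T : Type) (R : realType) (X : nat -> T -> R)
    (A B x : R) : set T :=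
  [set w | exists n : nat, first_passage X A B w = (n%:R)%:E /\ walk X n w = x].

(* Main.v *)
(* Condition on the first step.  For the walk started at x, let s_n(x), h_n(x)
   be the probabilities of surviving n steps, resp. of being absorbed at A
   within n steps.  The functions (x + B) / (A + B) and (A - x)(x + B) satisfy
   the one-step equations of the limits of h_n and of s_0 + ... + s_(n-1), so by
   induction on n their errors are at most s_n(x), resp. (A + B)^2 s_n(x).  The
   second bound shows that the series of the s_n converges, hence s_n -> 0 and
   both errors vanish; finally E[tau] is the sum of the P(tau > n).  Independence
   enters only through the cylinder events, where the first m steps are
   prescribed signs and which have probability 2^-m. *)
Require Import Defs.
From HB Require Import structures.
From mathcomp Require Import all_boot all_order all_algebra.
From mathcomp Require Import all_classical all_reals all_analysis.
From mathcomp Require Import ring lra.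

Set Implicit Arguments.
Unset Strict Implicit.
Unset Printing Implicit Defensive.
Import Order.TTheory GRing.Theory Num.Theory.
Import numFieldNormedType.Exports.

Local Open Scope classical_set_scope.
Local Open Scope ring_scope.

(* Watch a walk that is at x after m steps of Y for n more steps: the result
   is g (position) once a barrier is hit, and t if none is hit. *)
Fixpoint outcome (R : realType) (A B : R) (g : pred R) (t : bool)
    (Y : nat -> R) (n m : nat) (x : R) : bool :=
  if (x == A) || (x == - B) then g x
  else if n is k.+1 then outcome A B g t Y k m.+1 (x + Y m) else t.

(* The mean of [outcome] over fair +-1 steps. *)
Fixpoint value (R : realType) (A B : R) (g : pred R) (t : bool)
    (n : nat) (x : R) : R :=
  if (x == A) || (x == - B) then (g x)%:R
  else if n is k.+1 then
    (value A B g t k (x + 1) + value A B g t k (x - 1)) / 2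
  else t%:R.

(** * One-step recursions on the integer grid and their limits *)

Section Value.
Variables (R : realType) (A B : R).
Hypotheses (A_int : A \is a Num.int) (B_int : B \is a Num.int).
Hypotheses (A_gt0 : 0 < A) (B_gt0 : 0 < B).

(** These are s_n and h_n. With [g] false at both barriers and [t] true, only paths that meet no
    barrier count; with [pred1 c] and [false], only those absorbed at [c]. *)
Local Notation surv := (value A B xpred0 true).
Local Notation hit c := (value A B (pred1 c) false).

(** Integrality of the barriers enters here: strict inequality between integers leaves a gap of at
    least 1, so a unit step cannot jump over a barrier. *)
Lemma grid_neighbours (x : R) : x \is a Num.int -> - B <= x <= A ->
  (x == A) || (x == - B) = false ->
  [/\ x + 1 \is a Num.int, x - 1 \is a Num.int,
      - B <= x + 1 <= A & - B <= x - 1 <= A].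
Proof.
move=> xZ /andP[Bx xA] /norP[xneA xneB].
split; [by rewrite rpredD ?rpred1|by rewrite rpredB ?rpred1| |].
- apply/andP; split; first lra.
  have : x < A by rewrite lt_neqAle xneA.
  case/intrP: xZ => i ->; case/intrP: A_int => j ->.
  by rewrite ltr_int -[1]/(1%:~R) -intrD ler_int lezD1.
- apply/andP; split; last lra.
  have : - B < x by rewrite lt_neqAle eq_sym xneB.
  case/intrP: xZ => i ->; case/intrP: B_int => j ->.
  rewrite -intrN ltr_int -[1]/(1%:~R) -intrB ler_int.
  by rewrite lerBrDr lezD1.
Qed.

Lemma value_ge0 g t n (x : R) : 0 <= value A B g t n x.
Proof.
elim: n x => [|n IH] x /=; case: ifP => // _; try exact: ler0n.
by rewrite divr_ge0 ?addr_ge0.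
Qed.

(** Off the barriers the error is averaged over the two neighbours, exactly as [surv] is; at the
    barriers it is 0. For n = 0 the claim is that (x + B) / (A + B) lies in [0, 1]. *)
Lemma hit_top_approx n (x : R) : x \is a Num.int -> - B <= x <= A ->
  `|(x + B) / (A + B) - hit A n x| <= surv n x.
Proof.
have AB_gt0 : 0 < A + B by rewrite addr_gt0.
have ABn0 : A + B != 0 by rewrite gt_eqF.
have NBA : (- B == A) = false.
  by apply: lt_eqF; rewrite (@lt_trans _ _ 0) // oppr_lt0.
elim: n x => [|n IH] x xZ xI /=; case: ifP => [/orP[]/eqP-> | bar].
- by rewrite eqxx divff // subrr normr0.
- by rewrite NBA addNr mul0r subrr normr0.
- rewrite subr0 ger0_norm; first by rewrite ler_pdivrMr //=; lra.
  by rewrite divr_ge0 //; lra.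
- by rewrite eqxx divff // subrr normr0.
- by rewrite NBA addNr mul0r subrr normr0.
have [xZ1 xZ2 xI1 xI2] := grid_neighbours xZ xI bar.
have := IH _ xZ1 xI1; have := IH _ xZ2 xI2.
(* The neighbours' values become opposite shifts of the value at [x], which cancel in the average;
   what is left is linear. *)
have -> : (x + 1 + B) / (A + B) = (x + B) / (A + B) + (A + B)^-1 by field.
have -> : (x - 1 + B) / (A + B) = (x + B) / (A + B) - (A + B)^-1 by field.
by rewrite !ler_norml; move=> /andP[? ?] /andP[? ?]; apply/andP; split; lra.
Qed.

(** Transfers the limit at the top barrier to the bottom one, without a second harmonic estimate. *)
Lemma hit_sum n (x : R) : hit A n x + hit (- B) n x + surv n x = 1.
Proof.
have NBA : (- B == A) = false.
  by apply: lt_eqF; rewrite (@lt_trans _ _ 0) // oppr_lt0.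
have ANB : (A == - B) = false by rewrite eq_sym.
elim: n x => [|n IH] x /=; case: ifP => [/orP[]/eqP-> | bar].
- by rewrite eqxx ANB /=; lra.
- by rewrite eqxx NBA /=; lra.
- by rewrite /=; lra.
- by rewrite eqxx ANB /=; lra.
- by rewrite eqxx NBA /=; lra.
by have := IH (x + 1); have := IH (x - 1); lra.
Qed.

(* (A - x)(x + B) solves f(x) = 1 + (f(x + 1) + f(x - 1)) / 2 with zero
   boundary values, as the expected passage time from x should. *)
Lemma surv_sum_approx n (x : R) : x \is a Num.int -> - B <= x <= A ->
  0 <= (A - x) * (x + B) - \sum_(k < n) surv k x <= (A + B) ^+ 2 * surv n x.
Proof.
have bar0 y m : (y == A) || (y == - B) -> surv m y = 0.
  by case: m => [|m] /= ->.
elim: n x => [|n IH] x xZ xI; case: (boolP ((x == A) || (x == - B))) => bar.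
- rewrite big_ord0 bar0 // mulr0.
  by case/orP: bar => /eqP ->; apply/andP; split; nra.
(* Both A - x and x + B lie between 0 and A + B, whence the constant (A + B)^2. *)
- rewrite big_ord0 /= (negbTE bar) /=.
  by case/andP: xI => *; apply/andP; split; nra.
- rewrite big1 => [|i _]; last exact: bar0.
  by rewrite bar0 // mulr0; case/orP: bar => /eqP ->; apply/andP; split; nra.
have [xZ1 xZ2 xI1 xI2] := grid_neighbours xZ xI (negbTE bar).
(* The term k = 0 is the 1 of the one-step equation; the later terms are averages over the
   neighbours. *)
rewrite big_ord_recl /= (negbTE bar).
rewrite -mulr_suml big_split /=.
have := IH _ xZ1 xI1; have := IH _ xZ2 xI2.
set s1 := \sum_(_ < n) _; set s2 := \sum_(_ < n) _.
set v1 := value _ _ _ _ _ _; set v2 := value _ _ _ _ _ _.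
move=> /andP[? ?] /andP[? ?]; apply/andP; split; lra.
Qed.

Let grid0 : (0 : R) \is a Num.int /\ - B <= 0 <= A.
Proof. by split; [exact: rpred0|rewrite oppr_le0 !ltW]. Qed.

Lemma surv_cvg0 : surv n 0 @[n --> \oo] --> 0.
Proof.
apply: cvg_series_cvg_0; apply: nondecreasing_is_cvgn.
  apply/nondecreasing_seqP => n; rewrite /series /= big_nat_recr //=.
  by rewrite lerDl value_ge0.
(* A * B is (A - x)(x + B) at the starting point x = 0. *)
exists (A * B) => _ [n _ <-]; rewrite /series /= big_mkord.
case/andP: (surv_sum_approx n grid0.1 grid0.2) => + _.
by rewrite subr0 add0r subr_ge0.
Qed.

Lemma hit_top_cvg : hit A n 0 @[n --> \oo] --> B / (A + B).
Proof.
apply: (@squeeze_cvgr _ _ _ _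
    (fun n => B / (A + B) - surv n 0) (fun n => B / (A + B) + surv n 0)).
- apply: nearW => n; have := hit_top_approx n grid0.1 grid0.2.
  by rewrite add0r ler_norml => /andP[? ?]; apply/andP; split; lra.
- by rewrite -[X in _ --> X]subr0; apply: cvgB; [exact: cvg_cst|exact: surv_cvg0].
- by rewrite -[X in _ --> X]addr0; apply: cvgD; [exact: cvg_cst|exact: surv_cvg0].
Qed.

Lemma hit_bottom_cvg : hit (- B) n 0 @[n --> \oo] --> A / (A + B).
Proof.
(* The final 0 stands for the limit of [surv]. *)
have -> : A / (A + B) = 1 - B / (A + B) - 0.
  by rewrite subr0 -[X in X - _](@divff _ (A + B)) ?gt_eqF ?addr_gt0 // -mulrBl addrK.
have -> : (fun n => hit (- B) n 0) = (fun n => 1 - hit A n 0 - surv n 0).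
  by apply/funext => n; have := hit_sum n 0; lra.
by apply: cvgB; [apply: cvgB; [exact: cvg_cst|exact: hit_top_cvg]|exact: surv_cvg0].
Qed.

Lemma surv_series_cvg : series (fun n => surv n 0) @ \oo --> A * B.
Proof.
apply: (@squeeze_cvgr _ _ _ _
    (fun n => A * B - (A + B) ^+ 2 * surv n 0) (fun=> A * B)).
- apply: nearW => n; have := surv_sum_approx n grid0.1 grid0.2.
  by rewrite /series /= big_mkord subr0 add0r => /andP[? ?]; apply/andP; split; lra.
- rewrite -[X in _ --> X]subr0 -[X in _ - X](mulr0 ((A + B) ^+ 2)).
  by apply: cvgB; [exact: cvg_cst|apply: cvgM; [exact: cvg_cst|exact: surv_cvg0]].
- exact: cvg_cst.
Qed.

End Value.

(** * First hits along a single path *)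

Section Paths.
Variables (T : Type) (R : realType) (A B : R) (X : nat -> T -> R) (w : T).
Local Notation S n := (walk X n w).
Local Notation bar x := ((x == A) || (x == - B)).

Lemma walkS n : S n.+1 = S n + X n w.
Proof. by rewrite /walk big_ord_recr. Qed.

Lemma outcome_never g t n m : (forall k, ~~ bar (S k)) ->
  outcome A B g t (X^~ w) n m (S m) = t.
Proof.
move=> nobar; elim: n m => [|n IH] m /=; rewrite (negbTE (nobar m)) //.
by rewrite -walkS IH.
Qed.

(** The barrier is tested before the step budget, so a watch of n steps from time m covers the times
    m to m + n inclusive. *)
Lemma outcome_first g t n m N : bar (S N) ->
  (forall k, (k < N)%N -> ~~ bar (S k)) -> (m <= N)%N ->
  outcome A B g t (X^~ w) n m (S m) = if (N <= m + n)%N then g (S N) else t.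
Proof.
move=> barN nobar; elim: n m => [|n IH] m mN /=.
all: case: ifPn => [barm|nbarm].
- have -> : m = N.
    by apply/eqP; rewrite eqn_leq mN leqNgt; apply: contraL barm => /nobar.
  by rewrite leq_addr.
- have mltN : (m < N)%N by rewrite ltn_neqAle mN andbT; apply: contraNneq nbarm => ->.
  by rewrite addn0 leqNgt mltN.
- have -> : m = N.
    by apply/eqP; rewrite eqn_leq mN leqNgt; apply: contraL barm => /nobar.
  by rewrite leq_addr.
- have mltN : (m < N)%N by rewrite ltn_neqAle mN andbT; apply: contraNneq nbarm => ->.
  by rewrite -walkS IH // addSnnS.
Qed.

Lemma first_hitP : (forall k, ~~ bar (S k)) \/
  exists2 N, bar (S N) & forall k, (k < N)%N -> ~~ bar (S k).
Proof.
have [[k barS]|nobar] := pselect (exists k, bar (S k)); [right|left].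
  case: (ex_minnP (ex_intro (fun k => bar (S k)) k barS)) => N barN minN.
  by exists N => // j jN; apply: contraL jN => /minN; rewrite -leqNgt.
by move=> k; apply/negP => barS; apply: nobar; exists k.
Qed.

Lemma first_passage_never : (forall k, ~~ bar (S k)) ->
  first_passage X A B w = +oo%E.
Proof.
move=> nobar; rewrite /first_passage (_ : [set _ | _ in _] = set0) ?ereal_inf0 //.
rewrite -subset0 => _ [n /= hit _]; move/negP: (nobar n); apply.
by case: hit => ->; rewrite eqxx ?orbT.
Qed.

Lemma first_passage_first N : bar (S N) ->
  (forall k, (k < N)%N -> ~~ bar (S k)) ->
  first_passage X A B w = (N%:R)%:E.
Proof.
move=> barN nobar; apply/eqP; rewrite eq_le; apply/andP; split.
  by apply: ereal_inf_lbound; exists N => //=; case/orP: barN => /eqP; [left|right].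
apply: le_ereal_inf_tmp => _ [n /= hit <-]; rewrite lee_fin ler_nat leqNgt.
by apply/negP => /nobar; case: hit => ->; rewrite eqxx ?orbT.
Qed.

(** The n-th term is the indicator of tau > n, so the series counts the n below tau. This is the
    pathwise tail-sum formula, valid also when tau is +oo. *)
Lemma first_passage_series : first_passage X A B w =
  (\sum_(0 <= n <oo)
     (outcome A B xpred0 true (X^~ w) n 0 (S 0) : nat)%:R%:E)%E.
Proof.
have [nobar|[N barN nobar]] := first_hitP.
  rewrite first_passage_never //; apply/esym/cvg_lim => //.
  have -> : (fun n => \sum_(0 <= k < n)
      (outcome A B xpred0 true (X^~ w) k 0 (S 0) : nat)%:R%:E)%E =
      EFin \o (fun n => n%:R : R).
    apply/funext => n /=; rewrite sumEFin (eq_bigr (fun=> 1)); last first.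
      by move=> k _; rewrite outcome_never.
    by rewrite big_const_nat subn0 iter_addr_0.
  by apply/cvgeryP; exact: cvgr_idn.
rewrite (first_passage_first barN nobar); apply/esym/lim_near_cst => //.
near=> n; rewrite sumEFin; congr EFin.
have outE k : outcome A B xpred0 true (X^~ w) k 0 (S 0) = (k < N)%N.
  by rewrite (outcome_first _ _ _ barN nobar) //= add0n ltnNge; case: ifP.
have Nn : (N <= n)%N by near: n; exact: nbhs_infty_ge.
(* Cut at N: the terms before it are 1, the others 0. *)
rewrite (big_cat_nat (leq0n N) Nn) /= [X in _ + X]big_nat_cond.
rewrite [X in _ + X]big1 => [|k /andP[/andP[Nk _] _]]; last first.
  by rewrite outE ltnNge Nk.
rewrite addr0 big_nat_cond (eq_bigr (fun=> 1)) => [|k]; last first.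
  by rewrite outE andbT => /andP[_ ->].
by rewrite -big_nat_cond big_const_nat subn0 iter_addr_0.
Unshelve. all: by end_near. Qed.

End Paths.

(** Each set in the union depends on finitely many steps only, which gives access to measurability
    and continuity from below. *)
Lemma stopped_at_outcome (T : Type) (R : realType) (A B : R)
    (X : nat -> T -> R) (c : R) : c = A \/ c = - B ->
  stopped_at X A B c =
  \bigcup_n [set w | outcome A B (pred1 c) false (X^~ w) n 0 (walk X 0 w)].
Proof.
move=> cAB; apply/seteqP; split => w.
- case=> n [fpn Sn]; exists n => //=.
  have [nobar|[N barN nobar]] := first_hitP A B X w.
    by move: fpn; rewrite first_passage_never.
  move: fpn; rewrite (first_passage_first barN nobar) => -[] /eqP.
  rewrite eqr_nat => /eqP nN; subst n.
  by rewrite (outcome_first _ _ _ barN nobar) //= leqnn Sn eqxx.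
- case=> n _ /=.
  have [nobar|[N barN nobar]] := first_hitP A B X w.
    by rewrite outcome_never.
  rewrite (outcome_first _ _ _ barN nobar) //=; case: ifP => // _ /eqP SN.
  by exists N; rewrite (first_passage_first barN nobar).
Qed.

(** * From cylinder events to probabilities of outcomes *)

Section Probability.
Variables (R : realType) (d : measure_display) (T : measurableType d).
Variables (P : probability T R) (X : nat -> {RV P >-> R}) (A B : R).
Hypothesis X_indep : mutually_independent P X.
Hypothesis X_up : forall k, P [set w | X k w = 1] = (2^-1)%:E.
Hypothesis X_down : forall k, P [set w | X k w = - 1] = (2^-1)%:E.

Definition cylinder (c : nat -> R) (m : nat) : set T :=
  [set w | forall i, (i < m)%N -> X i w = c i].

Lemma measurable_step k (x : R) : measurable [set w | X k w = x].
Proof.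
have -> : [set w | X k w = x] = X k @^-1` [set x] by [].
exact: measurable_funPTI.
Qed.

Lemma cylinderE c m :
  cylinder c m = \bigcap_(i in [set` iota 0 m]) (X i @^-1` [set c i]).
Proof.
apply/seteqP; split => w cw i /=.
  by rewrite mem_iota /= add0n; exact: cw.
by move=> im; apply: cw; rewrite /= mem_iota.
Qed.

Lemma measurable_cylinder c m : measurable (cylinder c m).
Proof.
by rewrite cylinderE; exact: fin_bigcap_measurable.
Qed.

Lemma P_cylinder c m : (forall i, c i = 1 \/ c i = - 1) ->
  P (cylinder c m) = (2^-1 ^+ m)%:E.
Proof.
move=> c1; rewrite cylinderE (X_indep (E := fun i => [set c i])) ?iota_uniq //.
rewrite (eq_bigr (fun=> (2^-1 : R)%:E)); last first.
  by move=> i _; case: (c1 i) => ->; [exact: X_up|exact: X_down].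
by rewrite prodEFin big_const_seq count_predT size_iota iter_mulr_1.
Qed.

(** The two events are disjoint with total mass 1, so the other values of [X k] form a null
    event. *)
Lemma P_split k (F : set T) : measurable F ->
  P F = (P (F `&` [set w | (X k w = 1)%R]) +
         P (F `&` [set w | (X k w = - 1)%R]))%E.
Proof.
move=> mF.
set U := [set w | X k w = 1]; set D := [set w | X k w = - 1].
have mU : measurable U by exact: measurable_step.
have mD : measurable D by exact: measurable_step.
have UD0 : U `&` D = set0.
  rewrite -subset0 => w []; rewrite /U /D /= => -> /eqP; rewrite -subr_eq0 opprK.
  by rewrite -[1 + 1]/(2%:R) pnatr_eq0.
have PUD : P (~` (U `|` D)) = 0%E.
  rewrite probability_setC; last exact: measurableU.
  rewrite [X in (_ - X)%E](_ : _ = 1%E) ?subee // measureU //.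
  apply: (etrans (f_equal2 +%E (X_up k) (X_down k))).
  by rewrite -EFinD; congr EFin; lra.
rewrite (measureDI _ mF (measurableU _ _ mU mD)).
have mUD : measurable (U `|` D) by exact: measurableU.
rewrite (subset_measure0 (measurableD mF mUD) (measurableC mUD) _ PUD); last first.
  by move=> w [].
rewrite add0e setIUr measureU //; try exact: measurableI.
by rewrite setIACA UD0 setI0.
Qed.

Lemma measurable_walk n : measurable_fun setT (walk X n).
Proof.
apply: measurable_sum => i; exact: measurable_funPT.
Qed.

Definition outcome_event g t n m : set T :=
  [set w | outcome A B g t (X^~ w) n m (walk X m w)].

Lemma measurable_outcome_event (g : pred R) t n m : measurable [set x | g x] ->
  measurable (outcome_event g t n m).
Proof.
move=> mg.
have mwalk (p : pred R) k : measurable [set x | p x] ->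
    measurable [set w | p (walk X k w)].
  by move=> /(measurable_walk k measurableT); rewrite setTI.
have mbar : measurable [set x : R | (x == A) || (x == - B)].
  rewrite (_ : mkset _ = [set A] `|` [set - B]); first exact: measurableU.
  apply/seteqP; split => x /=; first by move=> /orP[]/eqP ->; [left|right].
  by case=> ->; rewrite eqxx ?orbT.
have mif (p q r : pred T) : measurable [set w | p w] ->
    measurable [set w | q w] -> measurable [set w | r w] ->
    measurable [set w | if p w then q w else r w].
  move=> mp mq mr; rewrite (_ : mkset _ =
      ([set w | p w] `&` [set w | q w]) `|` (~` [set w | p w] `&` [set w | r w])).
    by apply: measurableU; apply: measurableI => //; exact: measurableC.
  apply/seteqP; split => w /=.
    by case: ifPn => [pw qw|/negP pw rw]; [left|right].
  by case=> -[pw h]; [rewrite pw|rewrite (negbTE (introN idP pw))].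
elim: n m => [|n IH] m.
  apply: mif.
  - exact: mwalk mbar.
  - exact: mwalk.
  - by case: t; rewrite ?set_true ?set_false.
(* Absorbing the step into the walk at time m + 1 exposes a conditional whose last branch is covered
   by induction. *)
rewrite (_ : outcome_event _ _ _ _ = [set w |
    if (walk X m w == A) || (walk X m w == - B) then g (walk X m w)
    else outcome A B g t (X^~ w) n m.+1 (walk X m.+1 w)]); last first.
  by apply/seteqP; split => w; rewrite /outcome_event /= walkS.
apply: mif.
- exact: mwalk mbar.
- exact: mwalk.
- exact: IH.
Qed.

Lemma walk_cylinder c m w : cylinder c m w -> walk X m w = \sum_(i < m) c i.
Proof. by move=> cw; apply: eq_bigr => i _; exact: cw. Qed.

(** Fixing the next step stays within the family of cylinders, so the induction below can be
    iterated. *)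
Lemma cylinder_step c m x :
  cylinder c m `&` [set w | X m w = x] =
  cylinder (fun i => if i == m then x else c i) m.+1.
Proof.
apply/seteqP; split => w.
  case=> cw xw i; rewrite ltnS leq_eqVlt => /orP[/eqP ->|im].
    by rewrite eqxx.
  by rewrite ltn_eqF //; exact: cw.
move=> cw; split => [i im|] /=.
  by rewrite (cw i (ltnW im)) ltn_eqF.
by rewrite cw // eqxx.
Qed.

Lemma P_cylinder_const g t n m c (b : bool) :
  (forall i, c i = 1 \/ c i = - 1) ->
  (forall w, cylinder c m w ->
    outcome A B g t (X^~ w) n m (\sum_(i < m) c i) = b) ->
  P (cylinder c m `&` outcome_event g t n m) = (2^-1 ^+ m * b%:R)%:E.
Proof.
move=> c1 outb; case: b outb => outb.
  rewrite mulr1 -(P_cylinder _ c1); congr (P _); apply: setIidl => w cw.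
  by rewrite /outcome_event /= (walk_cylinder cw) outb.
rewrite mulr0 (_ : _ `&` _ = set0) ?measure0 // -subset0 => w [cw].
by rewrite /outcome_event /= (walk_cylinder cw) outb.
Qed.

(** Splitting on step m gives two cylinders of half the weight, ending at the two neighbours that
    [value] averages. Both [m] and [c] change, hence the generality. *)
Lemma P_cylinder_outcome (g : pred R) t n m c : measurable [set x | g x] ->
  (forall i, c i = 1 \/ c i = - 1) ->
  P (cylinder c m `&` outcome_event g t n m) =
  (2^-1 ^+ m * value A B g t n (\sum_(i < m) c i))%:E.
Proof.
move=> mg; elim: n m c => [|n IH] m c c1 /=; case: ifPn => bar.
- by apply: P_cylinder_const => // w _ /=; rewrite bar.
- by apply: P_cylinder_const => // w _ /=; rewrite (negbTE bar).
- by apply: P_cylinder_const => // w _ /=; rewrite bar.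
have -> : cylinder c m `&` outcome_event g t n.+1 m =
          cylinder c m `&` outcome_event g t n m.+1.
  apply/seteqP; split => w [cw]; rewrite /outcome_event /= (walk_cylinder cw).
    by rewrite (negbTE bar) -(walk_cylinder cw) -walkS.
  by rewrite (negbTE bar) -(walk_cylinder cw) -walkS.
rewrite (P_split m); last first.
  apply: measurableI; first exact: measurable_cylinder.
  exact: measurable_outcome_event.
have step x : x = 1 \/ x = -1 ->
    P (cylinder c m `&` outcome_event g t n m.+1 `&` [set w | X m w = x]) =
    (2^-1 ^+ m.+1 * value A B g t n (\sum_(i < m) c i + x))%:E.
  move=> x1; rewrite setIAC cylinder_step IH; last by move=> i; case: ifP.
  rewrite big_ord_recr /= eqxx; congr (_ * value _ _ _ _ _ (_ + _))%:E.
  by apply: eq_bigr => i _; rewrite ltn_eqF.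
rewrite !step; [|by right|by left].
by rewrite -EFinD exprSr; congr EFin; ring.
Qed.

Lemma P_outcome (g : pred R) t n : measurable [set x | g x] ->
  P (outcome_event g t n 0) = (value A B g t n 0)%:E.
Proof.
(* A cylinder of length 0 is the whole space, so the choice of signs is arbitrary. *)
move=> mg; have := P_cylinder_outcome t n 0 mg (c := fun=> 1) (fun=> or_introl erefl).
rewrite big_ord0 expr0 mul1r => <-; congr (P _); apply/esym/setIidr.
by move=> w _ i.
Qed.

(** * Limits: absorption probabilities and mean passage time *)

Hypotheses (A_int : A \is a Num.int) (B_int : B \is a Num.int).
Hypotheses (A_gt0 : 0 < A) (B_gt0 : 0 < B).

Lemma P_stopped_at c p : c = A \/ c = - B ->
  value A B (pred1 c) false n 0 @[n --> \oo] --> p ->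
  P (stopped_at X A B c) = p%:E.
Proof.
move=> cAB valp.
have mc : measurable [set x | pred1 c x].
  by rewrite (_ : mkset _ = [set c]) //; apply/seteqP; split => x /= /eqP.
rewrite stopped_at_outcome //.
set F := fun n : nat =>
  [set w | outcome A B (pred1 c) false (X^~ w) n 0 (walk X 0 w)].
have cvgF : P (F n) @[n --> \oo] --> P (\bigcup_n F n).
  apply: nondecreasing_cvg_mu.
  - by move=> n; exact: measurable_outcome_event.
  - by apply: bigcup_measurable => n _; exact: measurable_outcome_event.
  (* A longer watch does not change the outcome of a path already absorbed, so [F] increases. *)
  move=> n k nk; apply/subsetPset => w; rewrite /F /=.
  have [nobar|[N barN nobar]] := first_hitP A B X w.
    by rewrite outcome_never.
  rewrite !(outcome_first _ _ _ barN nobar) //= !add0n.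
  by case: ifP => // Nn; rewrite (leq_trans Nn nk).
apply: (cvg_unique _ cvgF) => //.
rewrite (_ : (fun n => _) = EFin \o (fun n => value A B (pred1 c) false n 0)).
  by apply: cvg_EFin => //; exact: nearW.
by apply/funext => n; exact: P_outcome.
Qed.

Lemma expectation_first_passage :
  (\int[P]_w first_passage X A B w)%E = (A * B)%:E.
Proof.
have m0 : measurable [set x : R | xpred0 x].
  by rewrite (_ : mkset _ = set0) // -subset0.
transitivity (\int[P]_w (\sum_(0 <= n <oo)
    (\1_(outcome_event xpred0 true n 0) w)%:E))%E.
  apply: eq_integral => w _; rewrite first_passage_series.
  apply: eq_eseriesr => n _; rewrite indicE; congr (_%:R)%:E; congr nat_of_bool.
  by apply/idP/idP => [h|/set_mem//]; apply/mem_set.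
(* Monotone convergence: the indicators are nonnegative, so sum and integral commute. *)
rewrite integral_nneseries //; last first.
  move=> n; apply/measurable_realfun.measurable_EFinP.
  by apply: measurable_realfun.measurable_indic; exact: measurable_outcome_event.
rewrite (eq_eseriesr (g := fun n => (value A B xpred0 true n 0)%:E)); last first.
  move=> n _; rewrite integral_indic //; last exact: measurable_outcome_event.
  by rewrite setIT; exact: P_outcome.
apply: cvg_lim => //.
rewrite (_ : (fun n => _) = EFin \o series (fun n => value A B xpred0 true n 0)).
  by apply: cvg_EFin; [exact: nearW|exact: surv_series_cvg].
by apply/funext => n; rewrite /= sumEFin.
Qed.

End Probability.

Theorem proposition4p1 (R : realType) (d : measure_display)
    (T : measurableType d) (P : probability T R) (X : nat -> {RV P >-> R})
    (A B : R)
    (X_indep : mutually_independent P X)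
    (X_ident : identically_distributed P X)
    (X_up : forall k, P [set w | X k w = 1] = (2^-1)%:E)
    (X_down : forall k, P [set w | X k w = - 1] = (2^-1)%:E)
    (A_gt0 : 0 < A) (B_gt0 : 0 < B)
    (A_int : A \is a Num.int) (B_int : B \is a Num.int) :
  [/\ P (stopped_at X A B A) = (B / (A + B))%:E,
      P (stopped_at X A B (- B)) = (A / (A + B))%:E
    & (\int[P]_w first_passage X A B w)%E = (A * B)%:E].
Proof.
split; last exact: expectation_first_passage.
  by apply: P_stopped_at => //; [left|exact: hit_top_cvg].
by apply: P_stopped_at => //; [right|exact: hit_bottom_cvg].
Qed.
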